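(* For a connected graph $G$, let $\varphi$ be the relation on $E(G)$ defined by: $\{u,v\}\mathrel{\varphi}\{x,y\}$ iff $d(u,x)=d(v,y)$ and $d(u,y)=d(v,x)$. Then, for any connected graph $G$: (i) $\varphi$ is reflexive and symmetric; (ii) $\varphi$ is in general not transitive (i.e. there exist connected graphs for which $\varphi$ is not transitive); (iii) two distinct edges sharing a vertex are never $\varphi$-related; (iv) two distinct edges lying on a common shortest path are never $\varphi$-related; (v) in the even cycle $C_{2\nu}$ ($\nu\ge 2$) the maximal sets of pairwise $\varphi$-related edges are exactly the $\nu$ antipodal pairs of edges; (vi) in the odd cycle $C_{2\nu+1}$ ($\nu\ge 1$) no two distinct edges are $\varphi$-related.
   Context: Graphs are finite, simple, connected and undirected; $d=d_G$ is the shortest-path distance. The relation $\varphi$ does not depend on which endpoint of each edge is named first. In the cycle $C_{2\nu}$ with vertices $v_0,\dots,v_{2\nu-1}$ (indices mod $2\nu$), the antipodal pairs of edges are the pairs $\{v_a v_{a+1},\, v_{a+\nu}v_{a+\nu+1}\}$. *)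

(* Defs.v *)
From mathcomp Require Import all_boot.

Set Implicit Arguments.
Unset Strict Implicit.
Unset Printing Implicit Defensive.

Record sgraph := SGraph {
  vertex :> finType;
  adj : rel vertex;
  adj_sym : symmetric adj;
  adj_irrefl : irreflexive adj
}.

Definition connected_graph (G : sgraph) : Prop :=
  forall x y : G, connect (@adj G) x y.

Definition edges (G : sgraph) : {set {set G}} :=
  [set [set p.1; p.2] | p : G * G & adj p.1 p.2].

(* Least n such that some walk with n edges joins x to y; the junk value #|G|
   is returned when there is no such walk (see dist_path and dist_min). *)
Definition dist (G : sgraph) (x y : G) : nat :=
  find (fun n => [exists p : n.-tuple G, path (@adj G) x p && (last x p == y)])
       (iota 0 #|G|).

Definition phi (G : sgraph) : rel {set G} := fun A B =>
  [exists u : G, exists v : G, exists x : G, exists y : G,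
    [&& adj u v, adj x y, A == [set u; v], B == [set x; y],
        dist u x == dist v y & dist u y == dist v x]].

Definition path_edges (G : sgraph) (x : G) (p : seq G) : seq {set G} :=
  pairmap (fun u v : G => [set u; v]) x p.

Definition shortest_path (G : sgraph) (x : G) (p : seq G) : bool :=
  path (@adj G) x p && (size p == dist x (last x p)).

Definition on_common_shortest_path (G : sgraph) (A B : {set G}) : Prop :=
  exists (x : G) (p : seq G),
    [/\ shortest_path x p, A \in path_edges x p & B \in path_edges x p].

Definition phi_related_set (G : sgraph) : pred {set {set G}} := fun S =>
  (S \subset edges G) &&
  [forall A in S, forall B in S, (A != B) ==> phi A B].

Lemma cshift_subproof n (a : 'I_n) k : (a + k) %% n < n.
Proof. by rewrite ltn_mod (leq_ltn_trans _ (ltn_ord a)). Qed.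

Definition cshift n (a : 'I_n) (k : nat) : 'I_n :=
  Ordinal (cshift_subproof a k).

(* The conjunct a != b only matters for n = 1, where it excludes a loop. *)
Definition cycle_adj n : rel 'I_n := fun a b =>
  (a != b) && ((b == cshift a 1) || (a == cshift b 1)).

Lemma cycle_adj_sym n : symmetric (@cycle_adj n).
Proof. by move=> a b; rewrite /cycle_adj eq_sym orbC. Qed.

Lemma cycle_adj_irrefl n : irreflexive (@cycle_adj n).
Proof. by move=> a; rewrite /cycle_adj eqxx. Qed.

(* This is the cycle C_n for n >= 3. *)
Definition cycle_graph (n : nat) : sgraph :=
  SGraph (@cycle_adj_sym n) (@cycle_adj_irrefl n).

Definition cycle_edge n (a : 'I_n) : {set cycle_graph n} :=
  [set a; cshift a 1].

Definition antipodal_pairs (nu : nat) : {set {set {set cycle_graph (2 * nu)}}} :=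
  [set [set cycle_edge a; cycle_edge (cshift a nu)] | a : 'I_(2 * nu)].

Lemma dist_min (G : sgraph) (x : G) (p : seq G) :
  path (@adj G) x p -> dist x (last x p) <= size p.
Proof.
move=> px; rewrite /dist; set P := fun n : nat => _.
have [ltpG|leGp] := ltnP (size p) #|G|; last first.
  by rewrite (leq_trans (find_size _ _)) ?size_iota.
rewrite leqNgt; apply/negP => /(before_find 0).
rewrite nth_iota // add0n => /negbT/negP; apply.
by apply/existsP; exists (in_tuple p); rewrite px eqxx.
Qed.

Lemma dist_path (G : sgraph) (x y : G) : connect (@adj G) x y ->
  exists2 p, shortest_path x p & last x p = y.
Proof.
case/connectP=> p0 p0x ->; case/shortenP: p0x => p px Up _.
set z := last x p; have ltpG: size p < #|G| by have := max_card (mem (x :: p)); rewrite (card_uniqP Up).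
have ltd : dist x z < #|G| := leq_ltn_trans (dist_min px) ltpG.
have := ltd; rewrite /dist; set P := fun n : nat => _.
rewrite -[X in _ < X -> _](size_iota 0) -has_find => /(nth_find 0).
rewrite nth_iota // add0n => /existsP[q /andP[qx /eqP qz]].
by exists q; rewrite // /shortest_path qx qz size_tuple /dist eqxx.
Qed.

Lemma phiE (G : sgraph) (u v x y : G) : adj u v -> adj x y ->
  phi [set u; v] [set x; y] = (dist u x == dist v y) && (dist u y == dist v x).
Proof.
have set2 (a b c d : G) : adj a b -> [set a; b] = [set c; d] ->
  a = c /\ b = d \/ a = d /\ b = c.
  move=> ab eqS.
  have: a \in [set c; d] by rewrite -eqS set21.
  have: b \in [set c; d] by rewrite -eqS set22.
  rewrite !inE => /orP[]/eqP eb /orP[]/eqP ea; subst; auto.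
    by rewrite adj_irrefl in ab.
  by rewrite adj_irrefl in ab.
move=> uv xy; apply/idP/idP; last first.
  move=> /andP[h1 h2]; apply/existsP; exists u; apply/existsP; exists v.
  apply/existsP; exists x; apply/existsP; exists y.
  by rewrite uv xy !eqxx h1 h2.
case/existsP=> u' /existsP[v' /existsP[x' /existsP[y']]].
case/and5P=> _ _ /eqP /(set2 _ _ _ _ uv) E1 /eqP /(set2 _ _ _ _ xy) E2.
by case/andP=> /eqP h1 /eqP h2; case: E1 E2 => -[-> ->] [] [-> ->];
  rewrite h1 h2 !eqxx.
Qed.

(* Main.v *)
(** Along a shortest path ..., u, v, ..., w, y, ... one has d(u, y) = d(v, w) + 2,
    which excludes uv phi wy.  In K_{2,3}, with sides {a0, a1} and {b0, b1, b2},
    a0 b0 and a0 b2 are both related to a1 b1 but not to each other.  In C_n, the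
    edges starting at positions a < b are related iff the two arcs between a and b
    have equal length: with k = b - a, the condition d(a, b+1) = d(a+1, b) reads
    min(k+1, n-k-1) = min(k-1, n-k+1), i.e. 2k = n. *)

Require Import Defs.
From mathcomp Require Import all_boot.
From mathcomp Require Import zify.

Set Implicit Arguments.
Unset Strict Implicit.
Unset Printing Implicit Defensive.

(** * Edges and the distance as a metric *)

Lemma edgesP (G : sgraph) (A : {set G}) :
  reflect (exists u v : G, adj u v /\ A = [set u; v]) (A \in edges G).
Proof.
apply: (iffP imsetP) => [[[u v]]|[u [v [uv ->]]]].
  by rewrite inE => uv ->; exists u, v.
by exists (u, v); rewrite ?inE.
Qed.

Lemma dist_refl (G : sgraph) (x : G) : dist x x = 0.
Proof. by apply/eqP; rewrite -leqn0; exact: (@dist_min G x [::]). Qed.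

Lemma dist_eq0 (G : sgraph) (x y : G) :
  connected_graph G -> dist x y = 0 -> x = y.
Proof.
move=> cG d0; have [p /andP[_ /eqP sp] py] := dist_path (cG x y).
by move: sp; rewrite py d0 => /size0nil p0; rewrite -py p0.
Qed.

Lemma dist_sym (G : sgraph) : connected_graph G -> commutative (@dist G).
Proof.
move=> cG; suff le (x y : G) : dist y x <= dist x y.
  by move=> x y; apply/eqP; rewrite eqn_leq !le.
have [p /andP[px /eqP sp] py] := dist_path (cG x y).
have qy : path (@adj G) (last x p) (rev (belast x p)).
  by rewrite rev_path; under eq_path do rewrite adj_sym.
have qx : last (last x p) (rev (belast x p)) = x.
  by case: (p) => //= z s; rewrite rev_cons last_rcons.
by have := dist_min qy; rewrite qx py size_rev size_belast sp py.
Qed.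

(* A function [f] that vanishes only at [x], grows by at most one along edges
   and decreases by one along some edge is the distance to [x]. *)
Section DistanceFunction.

Variables (G : sgraph) (x : G) (f : G -> nat).
Hypothesis f0 : forall z, f z = 0 <-> z = x.
Hypothesis f_lip : forall y z, adj y z -> f z <= (f y).+1.
Hypothesis f_dec : forall z, 0 < f z -> exists2 y, adj y z & f z = (f y).+1.

Lemma distfun_walk z :
  exists p, [/\ path (@adj G) x p, last x p = z & size p = f z].
Proof.
have [n fz] : exists n, f z = n by exists (f z).
elim: n z fz => [|n IHn] z fz.
  by exists [::]; split; rewrite // (f0 z).1.
have [|y yz] := @f_dec z; first by rewrite fz.
rewrite fz => -[/esym fy]; have [p [px py sp]] := IHn y fy.
by exists (rcons p z); rewrite rcons_path px py last_rcons size_rcons sp fy.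
Qed.

Lemma distfun_connect z : connect (@adj G) x z.
Proof. by have [p [px pz _]] := distfun_walk z; apply/connectP; exists p. Qed.

(** Descending from [z] along [f_dec] yields a walk of length [f z], the upper bound on the
    distance; [f_lip] summed along a geodesic gives the lower bound. *)
Lemma distfun_dist z : dist x z = f z.
Proof.
apply/eqP; rewrite eqn_leq; apply/andP; split.
  by have [p [px <- <-]] := distfun_walk z; exact: dist_min.
have [p /andP[px /eqP sp] pz] := dist_path (distfun_connect z).
suff le_path w q : path (@adj G) w q -> f (last w q) <= f w + size q.
  by have := le_path _ _ px; rewrite (f0 x).2 // pz add0n sp pz.
by elim: q w => /= [|y q IHq] w; [lia | case/andP=> /f_lip wy /IHq; lia].
Qed.

End DistanceFunction.

(** * Reflexivity, symmetry and incident edges *)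

Lemma phi_refl (G : sgraph) (A : {set G}) :
  connected_graph G -> A \in edges G -> phi A A.
Proof.
move=> cG /edgesP[u [v [uv ->]]].
by rewrite phiE // !dist_refl (dist_sym cG u) !eqxx.
Qed.

Lemma phi_sym (G : sgraph) (A B : {set G}) :
  connected_graph G -> A \in edges G -> B \in edges G -> phi A B -> phi B A.
Proof.
move=> cG /edgesP[u [v [uv ->]]] /edgesP[x [y [xy ->]]].
rewrite !phiE // => /andP[/eqP h1 /eqP h2].
by rewrite !(dist_sym cG x) !(dist_sym cG y) h1 h2 !eqxx.
Qed.

Lemma phi_related_pair (G : sgraph) (A B : {set G}) :
    connected_graph G -> A \in edges G -> B \in edges G -> phi A B ->
  phi_related_set [set A; B].
Proof.
move=> cG eA eB phiAB; apply/andP; split; first by apply/subsetP=> E /set2P[]->.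
apply/forall_inP=> E SE; apply/forall_inP=> F SF; apply/implyP.
by case/set2P: SE SF => -> /set2P[] ->; rewrite ?eqxx ?phiAB ?(phi_sym _ _ _ phiAB).
Qed.

Lemma edge_at (G : sgraph) (A : {set G}) u :
  A \in edges G -> u \in A -> exists2 v, adj u v & A = [set u; v].
Proof.
case/edgesP=> a [b [ab ->]]; rewrite !inE => /orP[] /eqP ->; first by exists b.
by exists a; rewrite 1?adj_sym // setUC.
Qed.

(** For edges [uv] and [uy] the relation demands d(u, u) = d(v, y), hence v = y and the edges
    coincide. *)
Lemma phi_incident (G : sgraph) (A B : {set G}) : connected_graph G ->
  A \in edges G -> B \in edges G -> A != B -> A :&: B != set0 -> ~ phi A B.
Proof.
move=> cG eA eB AB /set0Pn[u /setIP[uA uB]].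
have [v uv defA] := edge_at eA uA; have [y uy defB] := edge_at eB uB.
move: AB; rewrite defA defB phiE // dist_refl => /eqP AB.
by case/andP=> /eqP/esym/(dist_eq0 cG) vy _; rewrite vy in AB.
Qed.

(** * Edges on a common shortest path *)

Lemma path_edges_split (G : sgraph) (A : {set G}) x p : A \in path_edges x p ->
  exists p1 v p2, p = p1 ++ v :: p2 /\ A = [set last x p1; v].
Proof.
elim: p x => //= y p IHp x; rewrite inE => /orP[/eqP ->|/IHp].
  by exists [::], y, p.
by case=> p1 [v [p2 [-> ->]]]; exists (y :: p1), v, p2.
Qed.

Lemma shortest_path_edges (G : sgraph) (x v y : G) p1 p2 p3 :
    connected_graph G -> shortest_path x (p1 ++ v :: p2 ++ y :: p3) ->
  ~~ phi [set last x p1; v] [set last v p2; y].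
Proof.
move=> cG /andP[]; rewrite cat_path /= cat_path /= !last_cat /= last_cat /=.
case/and5P=> px1 uv vp2 wy yp3 /eqP sp; rewrite phiE //.
apply/negP=> /andP[_ /eqP duy].
have [q /andP[uq /eqP sq] qy] := dist_path (cG (last x p1) y).
have walk : path (@adj G) x (p1 ++ q ++ p3) by rewrite !cat_path px1 uq qy.
(* Replacing the segment from [last x p1] to [y] by a geodesic cannot shorten
   the path. *)
have := dist_min walk; rewrite !last_cat qy -sp !size_cat /= size_cat /= sq qy duy.
(* The geodesic has length d(v, w), at most [size p2], but the segment it replaces has [size p2 + 2]
   edges. *)
by have := dist_min vp2; lia.
Qed.

Lemma phi_common_shortest_path (G : sgraph) (A B : {set G}) :
    connected_graph G -> A \in edges G -> B \in edges G ->
  A != B -> on_common_shortest_path A B -> ~ phi A B.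
Proof.
move=> cG eA eB AB [x [p [sp /path_edges_split[p1 [v [p2 [defp defA]]]]]]].
rewrite defp /path_edges pairmap_cat mem_cat /= inE -defA eq_sym (negPf AB) /=.
(* [B] is traversed either before or after [A]; in the first case symmetry of [phi] restores the
   order expected by [shortest_path_edges]. *)
case/orP=> /path_edges_split[q1 [w [q2 [defq defB]]]] AphiB.
  move: sp; rewrite defp defq -catA /= => /(shortest_path_edges cG)/negP.
  have -> : last w q2 = last x p1 by rewrite defq last_cat.
  by rewrite -defA -defB; apply; apply: phi_sym.
move: sp; rewrite defp defq => /(shortest_path_edges cG)/negP.
by rewrite -defA -defB.
Qed.

(** * Failure of transitivity in the complete bipartite graph K_{2,3} *)

Definition k23_adj : rel (bool + 'I_3) := fun x y => is_inl x != is_inl y.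

Lemma k23_adj_sym : symmetric k23_adj.
Proof. by move=> x y; rewrite /k23_adj eq_sym. Qed.

Lemma k23_adj_irrefl : irreflexive k23_adj.
Proof. by move=> x; rewrite /k23_adj eqxx. Qed.

Definition k23 : sgraph := SGraph k23_adj_sym k23_adj_irrefl.

Definition k23_dist (x y : k23) : nat :=
  if x == y then 0 else if k23_adj x y then 1 else 2.

Lemma k23_distfun x :
  [/\ forall z, k23_dist x z = 0 <-> z = x,
      forall y z, @adj k23 y z -> k23_dist x z <= (k23_dist x y).+1
    & forall z, 0 < k23_dist x z ->
        exists2 y, @adj k23 y z & k23_dist x z = (k23_dist x y).+1].
Proof.
rewrite /k23_dist; split=> [z|y z|z].
- by rewrite (eq_sym x); case: eqP => //; case: ifP.
- move=> yz; case: (x =P z) => // _; case: (x =P y) => [->|_].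
    by rewrite [k23_adj y z]yz.
  by do 2!case: (k23_adj x _).
case: eqP => // xz _; case: ifP => xz'; first by exists x; rewrite ?eqxx.
(* Here [x] and [z] are distinct and on the same side, so any vertex of the opposite side is a
   common neighbour. *)
exists (if x is inl _ then inr ord0 else inl true); last first.
  by case: x {xz} xz'.
by case: x z {xz} xz' => [?|?] [?|?].
Qed.

Lemma k23_connected : connected_graph k23.
Proof.
by move=> x; have [f0 _ f_dec] := k23_distfun x; apply: distfun_connect f0 f_dec.
Qed.

Lemma k23_distE (x y : k23) : dist x y = k23_dist x y.
Proof. by have [f0 f_lip f_dec] := k23_distfun x; apply: distfun_dist. Qed.

Lemma phi_k23_not_trans :
  ~ (forall A B C : {set k23},
       A \in edges k23 -> B \in edges k23 -> C \in edges k23 ->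
       phi A B -> phi B C -> phi A C).
Proof.
pose a b : k23 := inl b; pose b i : k23 := inr (inord i).
have ab i j : adj (a i) (b j) by [].
have eab i j : [set a i; b j] \in edges k23 by apply/edgesP; exists (a i), (b j).
have nb i j : i < 3 -> j < 3 -> (b i == b j) = (i == j).
  by move=> ? ?; rewrite -[LHS]/(inord i == inord j :> 'I_3) -val_eqE /= !inordK.
(* The first and third edges share [a true]: their relation would give 0 = d(b 0, b 2) = 2. *)
move/(_ _ _ _ (eab true 0) (eab false 1) (eab true 2)).
by rewrite !phiE // !k23_distE /k23_dist /= !nb //= => /(_ isT isT).
Qed.

(** * Distances and [phi] in cycles *)

(** As [a + k < 2 * n], reduction modulo [n] subtracts [n] at most once. This linear form lets [lia]
    treat cyclic shifts. *)
Lemma cshift_val n (a : 'I_n) k :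
  k <= n -> cshift a k = a + k :> nat \/ cshift a k + n = a + k.
Proof.
move=> k_le /=; have ltan := ltn_ord a; case: (ltnP (a + k) n) => h.
  by left; exact: modn_small.
by right; rewrite -(subnK h) modnDr modn_small //; lia.
Qed.

Section CycleGraph.

Variable n : nat.
Hypothesis n_gt2 : 2 < n.

Local Notation C := (cycle_graph n).
Local Notation edge := (@cycle_edge n).

(** With truncated subtraction, [(a - b) + (b - a)] is the absolute difference, the length of one of
    the two arcs between [a] and [b]. *)
Definition cycle_dist (a b : nat) : nat :=
  minn ((a - b) + (b - a)) (n - ((a - b) + (b - a))).

Lemma cycle_adjE (a b : C) :
  adj a b = [|| b == a.+1 :> nat, a == b.+1 :> nat,
                (a == 0 :> nat) && (b == n.-1 :> nat)
              | (b == 0 :> nat) && (a == n.-1 :> nat)].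
Proof.
have [ltan ltbn] := (ltn_ord a, ltn_ord b).
rewrite [LHS]/(cycle_adj a b) /cycle_adj -!(inj_eq val_inj).
have := cshift_val b (ltnW (ltnW n_gt2)); have := cshift_val a (ltnW (ltnW n_gt2)).
move: (ltn_ord (cshift a 1)) (ltn_ord (cshift b 1)).
by move: (cshift a 1) (cshift b 1) => a' b' /=; lia.
Qed.

Lemma cycle_distfun (x : C) :
  [/\ forall z : C, cycle_dist x z = 0 <-> z = x,
      forall y z : C, adj y z -> cycle_dist x z <= (cycle_dist x y).+1
    & forall z : C, 0 < cycle_dist x z ->
        exists2 y : C, adj y z & cycle_dist x z = (cycle_dist x y).+1].
Proof.
have ltxn := ltn_ord x; rewrite /cycle_dist; split=> [z|y z|z].
- have ltzn := ltn_ord z; split=> [d0|->]; last by lia.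
  by apply/val_inj; rewrite /=; lia.
- by have [ltyn ltzn] := (ltn_ord y, ltn_ord z); rewrite cycle_adjE; lia.
have ltzn := ltn_ord z => dgt0.
suff [k [ltkn kz dk]] : exists k, [/\ k < n,
    [|| z == k.+1 :> nat, k == z.+1 :> nat,
        (k == 0) && (z == n.-1 :> nat) | (z == 0 :> nat) && (k == n.-1)]
  & cycle_dist x z = (cycle_dist x k).+1].
  by exists (Ordinal ltkn : C); rewrite ?cycle_adjE.
rewrite /cycle_dist.
(* Step from [z] towards [x] along the shorter arc. *)
pose down := (x < z) && (2 * (z - x) <= n) || (z < x) && (n < 2 * (x - z)).
have [|] := boolP down; rewrite /down {down} => towards.
  (* Stepping down from 0 wraps around to [n.-1]; below, stepping up from [n.-1] wraps around to
     0. *)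
  by have [z0|z_gt0] := posnP z; [exists n.-1 | exists z.-1]; split; lia.
by have [zn|z_lt] := eqVneq z.+1 n; [exists 0 | exists z.+1]; split; lia.
Qed.

Lemma cycle_connected : connected_graph C.
Proof.
move=> x z; have [f0 _ f_dec] := cycle_distfun x.
exact: (@distfun_connect C x (cycle_dist x) f0 f_dec z).
Qed.

Lemma dist_cycleE (x y : C) : dist x y = cycle_dist x y.
Proof.
have [f0 f_lip f_dec] := cycle_distfun x.
exact: (@distfun_dist C x (cycle_dist x) f0 f_lip f_dec y).
Qed.

Lemma adj_cshift1 (a : C) : adj a (cshift a 1 : C).
Proof.
move: (ltn_ord (cshift a 1)) (cshift_val a (ltnW (ltnW n_gt2))) (ltn_ord a).
by rewrite cycle_adjE; move: (cshift a 1) => a' /=; lia.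
Qed.

Lemma cycle_edge_in_edges (a : 'I_n) : edge a \in edges C.
Proof. by apply/edgesP; exists a, (cshift a 1); split; [exact: adj_cshift1|]. Qed.

Lemma cycle_edgesP (A : {set C}) : A \in edges C -> exists a, A = edge a.
Proof.
case/edgesP=> u [v [/andP[_ /orP[]/eqP->] ->]]; first by exists u.
by exists v; rewrite setUC.
Qed.

Lemma phi_cycle (a b : 'I_n) :
  phi (edge a) (edge b) = (a == b) || (2 * ((a - b) + (b - a)) == n).
Proof.
have [->|neq_ab] := eqVneq a b.
  by rewrite phi_refl ?cycle_edge_in_edges //; exact: cycle_connected.
wlog lt_ab : a b neq_ab / a < b => [IH|].
  have [/IH->//|lt_ba|/val_inj eq_ab] := ltngtP a b; last first.
    by rewrite eq_ab eqxx in neq_ab.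
  have neq_ba : b != a by rewrite eq_sym.
  rewrite [a - b + _]addnC -(IH b a neq_ba lt_ba).
  apply/idP/idP; apply: phi_sym; rewrite ?cycle_edge_in_edges //.
    exact: cycle_connected.
  exact: cycle_connected.
have ltbn := ltn_ord b.
have distE i j : i <= j -> cycle_dist i j = minn (j - i) (n - (j - i)).
  by rewrite /cycle_dist -subn_eq0 => /eqP->.
have distE0 i : cycle_dist i 0 = minn i (n - i) by rewrite /cycle_dist subn0 sub0n addn0.
rewrite phiE ?adj_cshift1 // !dist_cycleE.
have := cshift_val b (ltnW (ltnW n_gt2)); have := cshift_val a (ltnW (ltnW n_gt2)).
(* Since [a < b], only the successor of [b] can wrap around, and then it is 0. *)
move: (cshift a 1) (cshift b 1) => a' b' /= [->|a'E]; last by lia.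
case=> [->|b'E]; first by rewrite !distE; lia.
have -> : nat_of_ord b' = 0 by lia.
by rewrite !distE0 !distE; lia.
Qed.

(** If [a] and [b] differed, each would be the cyclic successor of the other, and [n] would divide
    2. *)
Lemma cycle_edge_inj : injective edge.
Proof.
move=> a b eqab; have [ltan ltbn] := (ltn_ord a, ltn_ord b).
have : a \in edge b by rewrite -eqab set21.
have : cshift a 1 \in edge b by rewrite -eqab set22.
rewrite !inE -!(inj_eq val_inj) => h1 h2; apply/val_inj; move: h1 h2.
have := cshift_val b (ltnW (ltnW n_gt2)); have := cshift_val a (ltnW (ltnW n_gt2)).
by move: (cshift a 1) (cshift b 1) => a' b' /=; lia.
Qed.

End CycleGraph.

(** * Antipodal pairs in even cycles *)

Section EvenCycle.

Variable nu : nat.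
Hypothesis nu_ge2 : 2 <= nu.

Local Notation C := (cycle_graph (2 * nu)).
Local Notation edge := (@cycle_edge (2 * nu)).

Let n_gt2 : 2 < 2 * nu. Proof. lia. Qed.
Let le_nu : nu <= 2 * nu. Proof. lia. Qed.

Definition antipodal_pair (a : 'I_(2 * nu)) : {set {set C}} :=
  [set edge a; edge (cshift a nu)].

Lemma phi_even_cycle (a b : 'I_(2 * nu)) :
  phi (edge a) (edge b) = (b == a) || (b == cshift a nu).
Proof.
have [ltan ltbn] := (ltn_ord a, ltn_ord b).
rewrite phi_cycle // -!(inj_eq val_inj); have := cshift_val a le_nu.
by move: (ltn_ord (cshift a nu)); move: (cshift a nu) => a' /=; lia.
Qed.

Lemma antipodal_pair_related a : phi_related_set (antipodal_pair a).
Proof.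
apply: phi_related_pair (@cycle_connected _ n_gt2) _ _ _;
  rewrite ?cycle_edge_in_edges //.
by rewrite phi_even_cycle eqxx orbT.
Qed.

(** An edge is related only to itself and its antipode. This inclusion yields both the maximality of
    the pairs and the absence of other maximal sets. *)
Lemma related_sub_antipodal_pair a (S : {set {set C}}) :
  phi_related_set S -> edge a \in S -> S \subset antipodal_pair a.
Proof.
case/andP=> /subsetP SE /forall_inP relS aS; apply/subsetP=> B SB.
have [b defB] := cycle_edgesP (SE _ SB).
have /forall_inP/(_ _ SB)/implyP := relS _ aS; rewrite defB !inE.
case: eqVneq => [->|neq_ab /(_ isT)] //=.
rewrite phi_even_cycle => /orP[]/eqP eq_b; last by rewrite eq_b.
by rewrite eq_b eqxx in neq_ab.
Qed.

Lemma maxset_related_antipodal :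
  [set S | maxset (@phi_related_set C) S] = antipodal_pairs nu.
Proof.
apply/setP=> S; rewrite inE; apply/maxsetP/imsetP=> [[relS maxS]|[a _ ->]].
  have [a aS] : exists a, edge a \in S.
    have [S0|[A AS]] := set_0Vmem S; last first.
      have [/subsetP/(_ _ AS)/cycle_edgesP[a defA] _] := andP relS.
      by exists a; rewrite -defA.
    (* An empty [S] is not maximal: the antipodal pair at position 0 would properly contain it. *)
    pose a0 : 'I_(2 * nu) := Ordinal (ltnW (ltnW n_gt2)).
    exists a0; rewrite -(maxS _ (antipodal_pair_related a0)) ?set21 //.
    by rewrite S0 sub0set.
  exists a => //; apply/esym/(maxS _ (antipodal_pair_related a)).
  exact: related_sub_antipodal_pair.
split=> [|T relT subT]; first exact: antipodal_pair_related.
apply/eqP; rewrite eqEsubset subT andbT.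
by apply: related_sub_antipodal_pair; rewrite // (subsetP subT) // set21.
Qed.

(** Two shifts by [nu] make a full turn, so a pair is listed once from each of its two edges. *)
Lemma antipodal_pair_cshift a : antipodal_pair (cshift a nu) = antipodal_pair a.
Proof.
rewrite /antipodal_pair; suff -> : cshift (cshift a nu) nu = a by rewrite setUC.
apply/val_inj; have := cshift_val (cshift a nu) le_nu; have := cshift_val a le_nu.
move: (ltn_ord a) (ltn_ord (cshift a nu)) (ltn_ord (cshift (cshift a nu) nu)).
by move: (cshift (cshift a nu) nu) (cshift a nu) => a'' a' /=; lia.
Qed.

(** The positions below [nu] represent every pair exactly once, a larger position being brought into
    this range by the shift. *)
Lemma card_antipodal_pairs : #|antipodal_pairs nu| = nu.
Proof.
have -> : antipodal_pairs nu = [set antipodal_pair (widen_ord le_nu i) | i : 'I_nu].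
  apply/setP=> S; apply/imsetP/imsetP=> [[a _ ->]|[i _ ->]]; last first.
    by exists (widen_ord le_nu i).
  have lta := ltn_ord a; have [lt_a|le_a] := ltnP a nu.
    exists (Ordinal lt_a) => //.
    by rewrite -/(antipodal_pair a); congr antipodal_pair; apply/val_inj.
  have lt_a : a - nu < nu by lia.
  exists (Ordinal lt_a) => //; rewrite -antipodal_pair_cshift -/(antipodal_pair a).
  congr antipodal_pair; apply/val_inj; rewrite /= in lta le_a lt_a *.
  by rewrite subnK // modn_small.
rewrite card_imset ?card_ord // => i j eqij.
have [lti ltj] := (ltn_ord i, ltn_ord j).
have : edge (widen_ord le_nu i) \in antipodal_pair (widen_ord le_nu j).
  by rewrite -eqij set21.
case/set2P=> /(cycle_edge_inj n_gt2)/(congr1 val) => [eq_ij|]; first exact: val_inj.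
(* The antipode of position [j < nu] is [j + nu], which cannot equal [i < nu]. *)
have := cshift_val (widen_ord le_nu j) le_nu.
by move: (cshift _ nu) => j' /= j'E eq_ij; lia.
Qed.

End EvenCycle.

Theorem theorem2p12 :
  (forall G : sgraph, connected_graph G ->
     (forall A : {set G}, A \in edges G -> phi A A) /\
     (forall A B : {set G}, A \in edges G -> B \in edges G ->
        phi A B -> phi B A)) /\
  (exists G : sgraph, connected_graph G /\
     ~ (forall A B C : {set G},
          A \in edges G -> B \in edges G -> C \in edges G ->
          phi A B -> phi B C -> phi A C)) /\
  (forall G : sgraph, connected_graph G ->
     forall A B : {set G}, A \in edges G -> B \in edges G ->
       A != B -> A :&: B != set0 -> ~ phi A B) /\
  (forall G : sgraph, connected_graph G ->
     forall A B : {set G}, A \in edges G -> B \in edges G ->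
       A != B -> on_common_shortest_path A B -> ~ phi A B) /\
  (forall nu : nat, 2 <= nu ->
     [set S | maxset (@phi_related_set (cycle_graph (2 * nu))) S]
       = antipodal_pairs nu
     /\ #|antipodal_pairs nu| = nu) /\
  (forall nu : nat, 1 <= nu ->
     forall A B : {set cycle_graph (2 * nu + 1)},
       A \in edges (cycle_graph (2 * nu + 1)) ->
       B \in edges (cycle_graph (2 * nu + 1)) ->
       A != B -> ~ phi A B).
Proof.
split=> [G cG|].
  by split=> [A|A B]; [exact: phi_refl | exact: phi_sym].
split; first by exists k23; split; [exact: k23_connected | exact: phi_k23_not_trans].
split=> [G|]; first by move=> cG A B; exact: phi_incident.
split=> [G|]; first by move=> cG A B; exact: phi_common_shortest_path.
split=> [nu nu_ge2|nu nu_ge1 A B].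
  by rewrite maxset_related_antipodal // card_antipodal_pairs.
have n_gt2 : 2 < 2 * nu + 1 by lia.
case/cycle_edgesP=> a -> /cycle_edgesP[b ->] neq_ab; rewrite phi_cycle //.
(* By [phi_cycle], distinct related edges would make the odd number [2 * nu + 1] even. *)
by case/orP=> [/eqP eq_ab|]; [rewrite eq_ab eqxx in neq_ab | lia].
Qed.
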